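(* Let $k,d\geq 1$ and $n\geq 2$ be integers. Then the $2d$-th Pythagoras number of $\mathcal{R}^k(\mathbb{R}^n)$ satisfies $$p_{2d}(n,2kd)\leq p_{2d}(\mathcal{R}^k(\mathbb{R}^n)).$$
   Context: For an integer $k\ge 0$, a function $f:\mathbb{R}^n\to\mathbb{R}$ is called $k$-regulous if it is of class $\mathcal{C}^k$ and is a rational function, i.e. there is a non-empty Zariski open subset $U\subset\mathbb{R}^n$ such that $f|_U$ is regular (a quotient of polynomials whose denominator does not vanish on $U$). The ring of $k$-regulous functions on $\mathbb{R}^n$ is denoted $\mathcal{R}^k(\mathbb{R}^n)$. For a commutative ring $A$ with identity, the $2d$-th Pythagoras number $p_{2d}(A)$ is the least positive integer $g$ such that any sum of $2d$-th powers of elements of $A$ can be expressed as a sum of $g$ $2d$-th powers of elements of $A$; if no such $g$ exists, $p_{2d}(A)=\infty$. An $n$-ary $k$-ic is a homogeneous polynomial of degree $k$ in $\mathbb{R}[x_1,\dots,x_n]$ (the zero polynomial included). The number $p_{2d}(n,2kd)$ is the least positive integer $g$ such that any sum of $2d$-th powers of $n$-ary $k$-ics can be presented as a sum of at most $g$ $2d$-th powers of $n$-ary $k$-ics; if no such $g$ exists, $p_{2d}(n,2kd)=\infty$. *)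

(* Defs.v *)
From HB Require Import structures.
From mathcomp Require Import all_boot all_order all_algebra.
From mathcomp Require Import all_classical all_reals all_analysis.
(* The notations of mpoly clash with those of mathcomp-analysis. *)
From mathcomp Require mpoly.
Import -(notations) mpoly.

Set Implicit Arguments.
Unset Strict Implicit.
Unset Printing Implicit Defensive.
Import Order.TTheory GRing.Theory Num.Theory numFieldNormedType.Exports.
Local Open Scope classical_set_scope.
Local Open Scope ring_scope.

Definition least_positive (P : nat -> Prop) : \bar int :=
  match pselect (exists g, (0 < g)%N && `[< P g >]) with
  | left exP => (Posz (ex_minn exP))%:E
  | right _ => +oo%E
  end.

Definition pythagoras_number (e : nat) (A : comPzRingType) : \bar int :=
  least_positive (fun g => forall s : seq A,
    exists t : g.-tuple A, \sum_(a <- s) a ^+ e = \sum_(a <- t) a ^+ e).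

(* [pythagoras_number_forms R e n k] is p_e(n, e * k); the zero polynomial
   satisfies [ishomog1 k mdeg] for every k. *)
Definition pythagoras_number_forms (R : realType) (e n k : nat) : \bar int :=
  least_positive (fun g => forall s : seq (mpoly n R),
    all [pred p | p \is ishomog1 k mdeg] s ->
    exists t : seq (mpoly n R),
      [/\ (size t <= g)%N, all [pred p | p \is ishomog1 k mdeg] t
        & \sum_(p <- s) p ^+ e = \sum_(p <- t) p ^+ e]).

Section Regulous.
Variables (R : realType) (n : nat).
Implicit Types (f g : 'rV[R]_n -> R) (U V : set 'rV[R]_n) (p q : mpoly n R).

Definition peval p (x : 'rV[R]_n) : R := meval (x ord0) p.

(* All iterated partial derivatives of order at most k exist everywhere and
   are continuous. *)
Fixpoint class_C (k : nat) f : Prop :=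
  match k with
  | 0 => continuous f
  | k'.+1 => continuous f /\ forall i : 'I_n,
      (forall x, derivable f x (delta_mx ord0 i)) /\
      class_C k' (fun x => 'D_(delta_mx ord0 i) f x)
  end.

Definition zariski_open U : Prop :=
  exists S : set (mpoly n R), U = [set x | exists2 p, S p & peval p x != 0].

Definition regular_on U f : Prop :=
  exists p q, forall x, U x -> peval q x != 0 /\ f x = peval p x / peval q x.

Definition rational_function f : Prop :=
  exists U, [/\ zariski_open U, U !=set0 & regular_on U f].

Definition regulous (k : nat) : {pred 'rV[R]_n -> R} :=
  [pred f | `[< class_C k f /\ rational_function f >]].

Lemma class_C_continuous k f : class_C k f -> continuous f.
Proof. by case: k => [|k] //= []. Qed.

Lemma class_CW k f : class_C k.+1 f -> class_C k f.
Proof.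
elim: k f => [|k IHk] f; first by case.
case=> cf df; split=> // i; have [dfi Cfi] := df i.
by split=> //; apply: IHk.
Qed.

Lemma class_C_cst k (c : R) : class_C k (cst c).
Proof.
elim: k c => [|k IHk] c; first exact: cst_continuous.
split; first exact: cst_continuous.
move=> i; split=> [x|]; first exact: derivable_cst.
rewrite (_ : (fun x => _) = cst 0); first exact: IHk.
by apply/funext => x; rewrite derive_cst.
Qed.

Lemma class_CB k f g : class_C k f -> class_C k g -> class_C k (f - g).
Proof.
have cB f' g' : continuous f' -> continuous g' -> continuous (f' - g').
  by move=> cf cg x; apply: continuousB; [exact: cf | exact: cg].
elim: k f g => [|k IHk] f g; first exact: cB.
move=> [cf df] [cg dg]; split; first exact: cB.
move=> i; have [dfi Cfi] := df i; have [dgi Cgi] := dg i.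
split=> [x|]; first exact: derivableB.
rewrite (_ : (fun x => _) = (fun x => 'D_(delta_mx ord0 i) f x) -
   (fun x => 'D_(delta_mx ord0 i) g x)); first exact: IHk.
by apply/funext => x; rewrite deriveB.
Qed.

Lemma class_CD k f g : class_C k f -> class_C k g -> class_C k (f + g).
Proof.
move=> Cf Cg; rewrite -[g]opprK; apply: class_CB => //.
by rewrite -[- g]add0r; apply: class_CB => //; exact: class_C_cst.
Qed.

Lemma class_CM k f g : class_C k f -> class_C k g -> class_C k (f * g).
Proof.
have cM f' g' : continuous f' -> continuous g' -> continuous (f' * g').
  by move=> cf cg x; apply: continuousM; [exact: cf | exact: cg].
elim: k f g => [|k IHk] f g; first exact: cM.
move=> Cf Cg; have [cf df] := Cf; have [cg dg] := Cg; split; first exact: cM.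
move=> i; have [dfi Cfi] := df i; have [dgi Cgi] := dg i.
split=> [x|]; first exact: derivableM.
rewrite (_ : (fun x => _) = f * (fun x => 'D_(delta_mx ord0 i) g x) +
   g * (fun x => 'D_(delta_mx ord0 i) f x)).
  by apply: class_CD; apply: IHk => //; exact: class_CW.
by apply/funext => x; rewrite deriveM.
Qed.

Lemma zariski_openI U V :
  zariski_open U -> zariski_open V -> zariski_open (U `&` V).
Proof.
move=> [S ->] [T ->]; exists [set r | exists p q, [/\ S p, T q & r = p * q]].
apply/seteqP; split=> x /=.
  move=> [[p Sp px] [q Tq qx]]; exists (p * q); first by exists p, q.
  by rewrite /peval mevalM mulf_neq0.
move=> [r [p [q [Sp Tq ->]]]]; rewrite /peval mevalM mulf_eq0 negb_or.
by move=> /andP[px qx]; split; [exists p | exists q].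
Qed.

Let restrict_line (x y : 'rV[R]_n) p : {poly R} :=
  mmap polyC (fun i => (x ord0 i)%:P + 'X * (y ord0 i - x ord0 i)%:P) p.

Let restrict_lineE x y p t :
  (restrict_line x y p).[t] = peval p (x + t *: (y - x)).
Proof.
rewrite /restrict_line /peval mevalE /mmap horner_sum; apply: eq_bigr => m _.
rewrite hornerM hornerC /mmap1 horner_prod; congr (_ * _).
by apply: eq_bigr => i _; rewrite horner_exp !hornerE !mxE.
Qed.

Lemma zariski_open_meets U V : zariski_open U -> zariski_open V ->
  U !=set0 -> V !=set0 -> (U `&` V) !=set0.
Proof.
move=> [S ->] [T ->] [x [p Sp px]] [y [q Tq qy]].
set P := restrict_line x y p; set Q := restrict_line x y q.
have P0 : P != 0.
  apply: contraNneq px => P0.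
  by rewrite -[x in peval p x]addr0 -(scale0r (y - x)) -restrict_lineE -/P P0 horner0.
have Q0 : Q != 0.
  apply: contraNneq qy => Q0.
  rewrite (_ : y = x + 1 *: (y - x)); last by rewrite scale1r addrC subrK.
  by rewrite -restrict_lineE -/Q Q0 horner0.
have PQ0 : P * Q != 0 by rewrite mulf_neq0.
have [t PQt] : exists t : R, ~~ root (P * Q) t.
  apply: contrapT => /forallNP roots.
  suff: (size [seq i%:R : R | i <- iota 0 (size (P * Q)%R)] < size (P * Q)%R)%N.
    by rewrite size_map size_iota ltnn.
  apply: max_poly_roots => //.
    by apply/allP => t _; apply: contrapT => /negP; exact: roots.
  by rewrite map_inj_uniq ?iota_uniq // => i j /eqP; rewrite eqr_nat => /eqP.
move: PQt; rewrite rootM negb_or /root !restrict_lineE => /andP[pt qt].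
by exists (x + t *: (y - x)); split; [exists p | exists q].
Qed.

Lemma zariski_openT : zariski_open setT.
Proof.
exists [set 1]; apply/seteqP; split=> // x _.
by exists 1 => //=; rewrite /peval meval1 oner_eq0.
Qed.

Lemma rational_function1 : rational_function 1.
Proof.
exists setT; split; [exact: zariski_openT | by exists 0 |].
by exists 1, 1 => x _; rewrite /peval meval1 oner_eq0 divr1.
Qed.

Lemma rational_function2 (op : (('rV[R]_n -> R) -> ('rV[R]_n -> R) -> ('rV[R]_n -> R))) f g :
  (forall U, regular_on U f -> regular_on U g -> regular_on U (op f g)) ->
  rational_function f -> rational_function g -> rational_function (op f g).
Proof.
move=> opfg [U [oU U0 [p [q rf]]]] [V [oV V0 [p' [q' rg]]]].
exists (U `&` V); split; [exact: zariski_openI | exact: zariski_open_meets |].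
apply: opfg.
  by exists p, q => x [Ux _]; exact: rf.
by exists p', q' => x [_ Vx]; exact: rg.
Qed.

Lemma rational_functionB f g :
  rational_function f -> rational_function g -> rational_function (f - g).
Proof.
apply: (rational_function2 (op := fun f g => f - g)) => U [p [q rf]] [p' [q' rg]].
exists (p * q' - p' * q), (q * q') => x Ux.
have [qx fx] := rf x Ux; have [q'x gx] := rg x Ux.
rewrite /peval in qx q'x fx gx *.
rewrite mevalB !mevalM mulf_neq0 //; split=> //.
by rewrite (_ : (f - g) x = f x - g x) // fx gx -mulNr addf_div // mulNr.
Qed.

Lemma rational_functionM f g :
  rational_function f -> rational_function g -> rational_function (f * g).
Proof.
apply: (rational_function2 (op := fun f g => f * g)) => U [p [q rf]] [p' [q' rg]].
exists (p * p'), (q * q') => x Ux.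
have [qx fx] := rf x Ux; have [q'x gx] := rg x Ux.
rewrite /peval in qx q'x fx gx *.
rewrite !mevalM mulf_neq0 //; split=> //.
by rewrite (_ : (f * g) x = f x * g x) // fx gx mulf_div.
Qed.

Lemma regulous_subring_closed k : subring_closed (regulous k).
Proof.
split=> [|f g /asboolP[Cf rf] /asboolP[Cg rg]|f g /asboolP[Cf rf] /asboolP[Cg rg]];
  apply/asboolP; split.
- exact: class_C_cst.
- exact: rational_function1.
- exact: class_CB.
- exact: rational_functionB.
- exact: class_CM.
- exact: rational_functionM.
Qed.

HB.instance Definition _ k :=
  GRing.isSubringClosed.Build ('rV[R]_n -> R) (regulous k)
    (regulous_subring_closed k).

Record regulous_ring (k : nat) := RegulousFun {
  regulous_fun :> 'rV[R]_n -> R;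
  _ : regulous_fun \in regulous k
}.

HB.instance Definition _ k := [isSub for @regulous_fun k].
HB.instance Definition _ k := [Choice of regulous_ring k by <:].
HB.instance Definition _ k :=
  GRing.SubChoice_isSubComPzRing.Build ('rV[R]_n -> R) (regulous k)
    (regulous_ring k) (regulous_subring_closed k).

End Regulous.

(* Main.v *)
(** If a sum [P] of [2d]-th powers of forms of degree [k] equals
    [\sum_j f_j ^ (2d)] with [f_j] of class [C^k], then [f_j ^ (2d) <= P], and
    homogeneity of [P] gives [f_j (t x) = O(t^k)].  Hence the Taylor expansion of
    [f_j] at the origin starts with a form [q_j] of degree [k], and dividing
    [P (t x)] by [t^(2dk)] and letting [t -> 0+] yields [P = \sum_j q_j ^ (2d)]. *)
Require Import Defs.
From mathcomp Require Import all_boot all_order all_algebra.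
From mathcomp Require Import all_classical all_reals all_analysis.
From mathcomp Require Import ring lra.
From mathcomp Require mpoly.
Import -(notations) mpoly.

Set Implicit Arguments.
Unset Strict Implicit.
Unset Printing Implicit Defensive.
Import Order.TTheory GRing.Theory Num.Theory numFieldNormedType.Exports.
Local Open Scope classical_set_scope.
Local Open Scope ring_scope.

(** * Directional derivatives and the gradient formula *)

Section DirectionalDerivatives.
Variables (R : realType) (n : nat).
Implicit Types (f : 'rV[R]_n -> R) (x u v : 'rV[R]_n).

(** Clearing the denominator of the difference quotient makes [h = 0] harmless, so the estimates
    below need no punctured neighbourhood. *)
Lemma is_deriveP f x v (l : R) : is_derive x v f l <->
  forall e, 0 < e -> exists2 r, 0 < r & forall h, `|h| < r ->
    `|f (x + h *: v) - f x - h * l| <= e * `|h|.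
Proof.
have estimate (e h : R) : h != 0 ->
    (`|l - h^-1 * (f (h *: v + x) - f x)| <= e) =
    (`|f (x + h *: v) - f x - h * l| <= e * `|h|).
  move=> h0; rewrite (_ : l - _ = - h^-1 * (f (x + h *: v) - f x - h * l)).
    by rewrite normrM normrN normfV ler_pdivrMl ?normr_gt0 // [e * _]mulrC.
  by rewrite [x + _]addrC [in RHS]mulrBr !mulNr mulKf // opprK [RHS]addrC.
split=> [[dfx dl] e e0|H].
  have : (fun h => h^-1 *: ((f \o shift x) (h *: v) - f x)) @ 0^' --> l.
    by rewrite -dl.
  move=> /cvgrPdist_le/(_ e e0).
  move=> /nbhs_ballP[r /= r0 H]; exists r => // h hr.
  have [->|h0] := eqVneq h 0.
    by rewrite scale0r addr0 subrr mul0r subrr !normr0 mulr0.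
  rewrite -estimate //; apply: H => //=.
  by rewrite /ball /= sub0r normrN.
have cv : (fun h => h^-1 *: ((f \o shift x) (h *: v) - f x)) @ 0^' --> l.
  apply/cvgrPdist_le => e e0; have [r r0 Hr] := H e e0.
  apply/nbhs_ballP; exists r => //= h; rewrite /ball /= sub0r normrN => hr h0.
  by rewrite estimate //; exact: Hr.
by split; [apply/cvg_ex; exists l | exact: cvg_lim].
Qed.

(** Both difference quotients are the same function of [h]. This brings directional derivatives down
    to one real variable, where the mean value theorem applies. *)
Lemma is_derive_along_line f x v (t : R) :
  derivable f (x + t *: v) v ->
  is_derive t 1 (fun s => f (x + s *: v)) ('D_v f (x + t *: v)).
Proof.
have E : (fun h : R => h^-1 *: (((fun s => f (x + s *: v)) \o shift t) (h *: 1)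
    - f (x + t *: v))) =
    (fun h : R => h^-1 *: ((f \o shift (x + t *: v)) (h *: v) - f (x + t *: v))).
  apply/funext => h /=; congr (_ *: (f _ - _)).
  by rewrite [h *: 1]mulr1 scalerDl addrCA.
by move=> df; apply: DeriveDef; rewrite ?/derivable ?/derive E.
Qed.

Lemma is_deriveZv f x v (c l : R) : is_derive x v f l ->
  is_derive x (c *: v) f (c * l).
Proof.
move=> /is_deriveP df; apply/is_deriveP => e e0.
(* The added 1 keeps the divisor positive when [c = 0]. *)
have c1 : 0 < `|c| + 1 by rewrite ltr_wpDl.
have [r r0 H] := df _ (divr_gt0 e0 c1).
exists (r / (`|c| + 1)) => [|h]; first exact: divr_gt0.
rewrite ltr_pdivlMr // => hr; rewrite scalerA mulrA.
have hc : `|h * c| <= `|h| * (`|c| + 1).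
  by rewrite normrM ler_wpM2l // lerDl.
apply: le_trans (H (h * c) _) _; first exact: le_lt_trans hr.
apply: le_trans (ler_wpM2l (ltW (divr_gt0 e0 c1)) hc) _.
by rewrite mulrCA mulrC mulfVK // gt_eqF.
Qed.

(** The increment is split at [x + h *: u]: the first piece is the derivative along [u], the second
    is [h] times a value of ['D_v f] at a nearby point, which continuity at [x] compares with
    ['D_v f x]. Only the direction [v] has to have a continuous derivative. *)
Lemma is_derive_addv f x u v (l : R) : is_derive x u f l ->
  (forall y, derivable f y v) -> {for x, continuous (fun y => 'D_v f y)} ->
  is_derive x (u + v) f (l + 'D_v f x).
Proof.
move=> /is_deriveP df dfv /cvgrPdist_le cfv; apply/is_deriveP => e e0.
have e2 : 0 < e / 2 by rewrite divr_gt0.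
have [r1 r10 H1] := df _ e2.
have /nbhs_ballP[r2 /= r20 H2] := cfv _ e2.
(* The mean value point lies within [|h| * (|u| + |v|)] of [x]; dividing [r2] by this sum plus 1
   keeps it in the ball of radius [r2]. *)
have M0 : 0 < `|u| + `|v| + 1 by rewrite ltr_wpDl ?addr_ge0.
exists (Num.min r1 (r2 / (`|u| + `|v| + 1))) => [|h].
  by rewrite lt_min r10 divr_gt0.
rewrite lt_min ltr_pdivlMr // => /andP[hr1 hr2].
have dw (s : R) : is_derive s 1 (fun s : R => f ((x + h *: u) + s *: (h *: v)))
    (h * 'D_v f ((x + h *: u) + s *: (h *: v))).
  have D := is_deriveZv h (derivableP (dfv ((x + h *: u) + s *: (h *: v)))).
  by rewrite -(@derive_val _ _ _ _ _ _ _ D); exact: is_derive_along_line.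
have [s s01 /=] := MVT ltr01 (fun s _ => dw s)
  (derivable_within_continuous (fun s _ => @ex_derive _ _ _ _ _ _ _ (dw s))).
rewrite scale1r scale0r addr0 subr0 mulr1 => E.
rewrite scalerDr addrA.
have -> : f (x + h *: u + h *: v) - f x - h * (l + 'D_v f x) =
   h * ('D_v f (x + h *: u + s *: (h *: v)) - 'D_v f x)
    + (f (x + h *: u) - f x - h * l) by rewrite mulrBr -E; ring.
rewrite (_ : e * `|h| = `|h| * (e / 2) + e / 2 * `|h|); last by field.
apply: le_trans (ler_normD _ _) (lerD _ (H1 _ hr1)).
rewrite normrM ler_wpM2l // distrC; apply: H2.
rewrite -ball_normE /= -addrA opprD addrA subrr add0r normrN.
move: s01; rewrite in_itv /= => /andP[s0 s1].
apply: le_lt_trans hr2; apply: le_trans (ler_normD _ _) _.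
rewrite !normrZ !mulrDr mulr1 -addrA lerD2l ler_wpDr // ler_piMl ?mulr_ge0 //.
by rewrite ger0_norm ltW.
Qed.

(** The vector [v] is assembled from its coordinate components, and each new component is the
    direction with continuous derivative in [is_derive_addv]. *)
Lemma is_derive_gradient f x v :
  (forall i y, derivable f y (delta_mx ord0 i)) ->
  (forall i, continuous (fun y => 'D_(delta_mx ord0 i) f y)) ->
  is_derive x v f (\sum_(i < n) v ord0 i * 'D_(delta_mx ord0 i) f x).
Proof.
move=> df cf; rewrite {1}[v]row_sum_delta.
elim: (index_enum _) => [|i s IHs]; first by rewrite !big_nil; exact: is_derive0.
rewrite !big_cons addrC [in X in is_derive _ _ _ X]addrC.
have D y := is_deriveZv (v ord0 i) (derivableP (df i y)).
have DE y := @derive_val _ _ _ _ _ _ _ (D y).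
rewrite -DE; apply: is_derive_addv => //.
rewrite (_ : (fun y => _) = (fun y => v ord0 i * 'D_(delta_mx ord0 i) f y)).
  by apply: continuousM; [exact: cst_continuous | exact: cf].
by apply/funext => y; exact: DE.
Qed.

End DirectionalDerivatives.

(** Reduces the theorem to one fixed [g]; when no [g] satisfies [Q], the right-hand side is
    infinite. *)
Lemma le_least_positive (P Q : nat -> Prop) : (forall g, Q g -> P g) ->
  (least_positive P <= least_positive Q)%E.
Proof.
move=> QP; rewrite /least_positive.
case: (pselect (exists g, (0 < g)%N && `[< Q g >])) => [exQ|_]; last exact: leey.
case: ex_minnP => g /andP[g_gt0 /asboolP Qg] _.
have Pg : (0 < g)%N && `[< P g >] by rewrite g_gt0; apply/asboolP/QP.
case: pselect => [exP|/(_ (ex_intro _ g Pg))//].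
by rewrite lee_fin lez_nat; case: ex_minnP => m _; exact.
Qed.

(** * Polynomials are determined by their values *)

Lemma base_expansion_inj n (N : nat) (a b : 'I_n -> nat) :
  (forall i, a i < N)%N -> (forall i, b i < N)%N ->
  (\sum_(i < n) N ^ i * a i = \sum_(i < n) N ^ i * b i)%N -> a =1 b.
Proof.
elim: n a b => [|n IHn] a b aN bN; first by move=> _ [].
have N_gt0 : (0 < N)%N by exact: leq_ltn_trans (aN ord0).
have step c : (\sum_(i < n.+1) N ^ i * c i
    = (\sum_(i < n) N ^ i * c (lift ord0 i)) * N + c ord0)%N.
  rewrite big_ord_recl mul1n addnC big_distrl; congr addn.
  by apply: eq_bigr => i _; rewrite /= /bump add1n expnS -mulnA mulnC.
rewrite !step => eq_ab.
(* Uniqueness of base-[N] digits: reduction modulo [N] isolates the lowest digit, and induction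
   handles the quotient. *)
have eq0 : a ord0 = b ord0.
  by move/(congr1 (modn^~ N)): eq_ab; rewrite !modnMDl !modn_small.
move: eq_ab; rewrite eq0 => /addIn /eqP; rewrite eqn_pmul2r // => /eqP /IHn eqS.
move=> i; case: (unliftP ord0 i) => [j|] ->; last by [].
by apply: (eqS _ _ j) => ?.
Qed.

(** The integers [0, ..., size p - 1] are distinct and too many to be all roots. *)
Lemma poly_nonroot (R : numDomainType) (p : {poly R}) :
  p != 0 -> exists t, p.[t] != 0.
Proof.
move=> p0; apply: contrapT => /forallNP roots.
suff: (size [seq i%:R : R | i <- iota 0 (size p)] < size p)%N.
  by rewrite size_map size_iota ltnn.
apply: max_poly_roots => //.
  by apply/allP => t _; apply: contrapT => /negP; exact: roots.
by rewrite map_inj_uniq ?iota_uniq // => i j /eqP; rewrite eqr_nat => /eqP.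
Qed.

(* Kronecker substitution: [x_i := t ^ (N ^ i)] with [N] above all exponents
   sends distinct monomials to distinct powers of [t]. *)
Lemma mpoly_nonroot (R : realType) n (p : mpoly n R) :
  p != 0 -> exists x : 'rV[R]_n, peval p x != 0.
Proof.
move=> p0; set N := msize p.
pose w (m : multinom n) := (\sum_(i < n) N ^ i * m i)%N.
have w_inj : {in msupp p &, injective w}.
  have small m : m \in msupp p -> forall i, (m i < N)%N.
    move=> mp i; apply: leq_ltn_trans (msize_mdeg_lt mp).
    by rewrite mdegE (bigD1 i) //= leq_addr.
  move=> m1 m2 m1p m2p /base_expansion_inj eqm; apply/mnmP => i.
  by apply: eqm; exact: small.
pose P : {poly R} := \sum_(m <- msupp p) mcoeff m p *: 'X^(w m).
have PE t : P.[t] = peval p (\row_i t ^+ (N ^ i)).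
  rewrite /peval mevalE horner_sum; apply: eq_bigr => m _.
  rewrite hornerZ hornerXn /w -prodrXr; congr (_ * _).
  by apply: eq_bigr => i _; rewrite mxE exprM.
have [m mp] : exists m, m \in msupp p.
  move: p0; rewrite -msupp_eq0; case: (msupp p) => // m s _.
  by exists m; rewrite mem_head.
have P0 : P != 0.
  apply/eqP => P0; suff: mcoeff m p == 0 by rewrite mcoeff_eq0 mp.
  (* By injectivity of [w] on the support, only [m] contributes to this coefficient. *)
  have : P`_(w m) = 0 by rewrite P0 coef0.
  rewrite coef_sum (bigD1_seq m) ?msupp_uniq //=.
  rewrite coefZ coefXn eqxx mulr1.
  rewrite big_seq_cond big1 ?addr0; first by move=> ->.
  move=> m' /andP[m'p m'm]; rewrite coefZ coefXn.
  rewrite (negPf (contraNneq _ m'm)) ?mulr0 // => eq_w.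
  by apply/eqP/w_inj.
have [t Pt] := poly_nonroot P0.
by exists (\row_i t ^+ (N ^ i)); rewrite -PE.
Qed.

(** Allows the final identity between sums of powers of forms to be checked pointwise. *)
Lemma peval_inj (R : realType) n (p q : mpoly n R) :
  peval p =1 peval q -> p = q.
Proof.
move=> pq; apply/eqP; rewrite -subr_eq0; apply: contrapT => /negP.
by move=> /mpoly_nonroot[x]; rewrite /peval mevalB -!/(peval _ _) pq subrr eqxx.
Qed.

Lemma peval_homog (R : realType) n k (p : mpoly n R) (t : R) (x : 'rV[R]_n) :
  p \is ishomog1 k mdeg -> peval p (t *: x) = t ^+ k * peval p x.
Proof.
move=> /dhomogP hp; rewrite /peval !mevalE mulr_sumr !big_seq.
apply: eq_bigr => m /hp mk; rewrite mulrCA; congr (_ * _).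
under eq_bigr => i _ do rewrite mxE exprMn.
by rewrite big_split /= prodrXr -mdegE; congr (_ ^+ _ * _).
Qed.

(** * Polynomial functions as elements of the regulous ring *)

Section PolynomialsAreRegulous.
Variables (R : realType) (n : nat).

Lemma class_C_coord k (i : 'I_n) : class_C k (fun x : 'rV[R]_n => x ord0 i).
Proof.
have dC j (x : 'rV[R]_n) : is_derive x (delta_mx ord0 j)
    (fun x : 'rV[R]_n => x ord0 i) ((i == j)%:R).
  apply/is_deriveP => e e0; exists 1 => // h _.
  rewrite !mxE eqxx /= [x ord0 i + _]addrC addrK subrr normr0.
  by rewrite mulr_ge0 // ltW.
case: k => [|k]; first exact: coord_continuous.
split=> [|j]; first exact: coord_continuous.
split=> [x|]; first by have := dC j x => -[].
rewrite (_ : (fun x => _) = cst ((i == j)%:R)); first exact: class_C_cst.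
by apply/funext => x; rewrite derive_val.
Qed.

Lemma class_C_peval k (p : mpoly n R) : class_C k (peval p).
Proof.
have sumC (I : Type) (s : seq I) (F : I -> 'rV[R]_n -> R) :
    (forall i, class_C k (F i)) -> class_C k (fun x => \sum_(i <- s) F i x).
  move=> CF; rewrite -fct_sumE; elim/big_rec: _ => [|i f _ Cf]; first exact: class_C_cst.
  exact: class_CD.
have prodC (I : Type) (s : seq I) (F : I -> 'rV[R]_n -> R) :
    (forall i, class_C k (F i)) -> class_C k (fun x => \prod_(i <- s) F i x).
  move=> CF; rewrite -fct_prodE; elim/big_rec: _ => [|i f _ Cf]; first exact: class_C_cst.
  exact: class_CM.
have -> : peval p = (fun x => \sum_(m <- msupp p) (cst (mcoeff m p) *
   (fun x : 'rV[R]_n => \prod_(i <- index_enum 'I_n) x ord0 i ^+ m i)) x).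
  by apply/funext => x; rewrite /peval mevalE.
apply: sumC => m; apply: class_CM; first exact: class_C_cst.
apply: (prodC _ _ (fun i x => x ord0 i ^+ m i)) => i.
(* A power is rewritten as a product of equal factors so that [prodC] covers it. *)
have -> : (fun x : 'rV[R]_n => x ord0 i ^+ m i) =
   (fun x => \prod_(j <- iota 0 (m i)) x ord0 i).
  by apply/funext => x; rewrite big_const_seq count_predT size_iota -Monoid.iteropE.
by apply: prodC => _; exact: class_C_coord.
Qed.

Lemma regulous_peval k (p : mpoly n R) : peval p \in @regulous R n k.
Proof.
apply/asboolP; split; first exact: class_C_peval.
exists setT; split; [exact: zariski_openT | by exists 0 |].
by exists p, 1 => x _; rewrite /peval meval1 oner_eq0 divr1.
Qed.

Definition regulous_of_mpoly k (p : mpoly n R) : regulous_ring R n k :=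
  RegulousFun (regulous_peval k p).

End PolynomialsAreRegulous.

(** * Taylor expansions along rays and leading forms *)

Section TaylorForms.
Variables (R : realType) (n : nat).
Implicit Types (f : 'rV[R]_n -> R) (x : 'rV[R]_n).

(* The Taylor expansion at the origin is only stated along rays [t *: x],
   [t >= 0], and not uniformly in [x]. *)
Definition taylor_forms k f (q : nat -> mpoly n R) : Prop :=
  (forall j, q j \is ishomog1 j mdeg) /\
  forall x e, 0 < e -> exists2 r, 0 < r & forall t, 0 <= t < r ->
    `|f (t *: x) - \sum_(j < k.+1) t ^+ j * peval (q j) x| <= e * t ^+ k.

(** Induction on [k]: the expansions of the partial derivatives are integrated along each ray, and
    the mean value theorem turns an error of order [t ^+ k] in the derivative into one of order
    [t ^+ k.+1]. *)
Lemma class_C_taylor k f : class_C k f -> exists q, taylor_forms k f q.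
Proof.
elim: k f => [|k IHk] f Cf.
  exists (fun j => if j is 0 then mpolyC n (f 0) else 0); split.
    move=> [|j]; last exact: dhomog0.
    by rewrite -[mpolyC _ _]mulr1 mul_mpolyC; apply/dhomogZ/dhomog1.
  move=> x e e0.
  have cf : {for (0 : R), continuous (fun t : R => f (t *: x))}.
    apply: continuous_comp; first exact: scalel_continuous.
    exact: class_C_continuous Cf _.
  move/cvgrPdist_le : cf => /(_ e e0) /nbhs_ballP[r /= r0 H].
  exists r => // t /andP[t0 tr].
  rewrite big_ord1 !expr0 mul1r mulr1 /peval mevalC distrC.
  have := H t; rewrite /ball /= sub0r normrN ger0_norm // scale0r; exact.
have [cf df] := Cf.
have dfx i y : derivable f y (delta_mx ord0 i) by have [] := df i.
have Cdf i : class_C k (fun y => 'D_(delta_mx ord0 i) f y) by have [] := df i.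
have /boolp.choice[Q HQ] : forall i, exists Q,
    taylor_forms k (fun y => 'D_(delta_mx ord0 i) f y) Q.
  by move=> i; exact: IHk.
(* Euler's identity for a form of degree [j'.+1] dictates this choice, with [Q i j'] in the role of
   its [i]-th partial derivative. *)
pose q j := if j is j'.+1 then
    (j'.+1%:R^-1 : R) *: \sum_(i < n) (mpolyX R (mnm1 i) * Q i j')
  else mpolyC n (f 0).
have q0 : q 0%N \is ishomog1 0 mdeg.
  by rewrite /q -[mpolyC _ _]mulr1 mul_mpolyC; apply/dhomogZ/dhomog1.
exists q; split=> [[|j] //|x e e0].
  apply/dhomogZ/rpred_sum => i _; rewrite -[j.+1]add1n.
  apply: dhomogM; last by have [+ _] := HQ i; exact.
  by rewrite dhomogX /= mdeg1.
have qE j : j.+1%:R * peval (q j.+1) x = \sum_(i < n) x ord0 i * peval (Q i j) x.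
  rewrite /peval /q mevalZ mulrA mulfV ?pnatr_eq0 // mul1r raddf_sum.
  by apply: eq_bigr => i _; rewrite /= mevalM mevalXU.
(* The errors of the partial derivatives get weighted by the coordinates of [x]; allotting [e / S]
   to each keeps their total below [e]. *)
pose S := 1 + \sum_(i < n) `|x ord0 i|.
have S0 : 0 < S by rewrite ltr_pwDl // sumr_ge0.
have [r r0 Hr] : exists2 r, 0 < r & forall i t, 0 <= t < r ->
    `|'D_(delta_mx ord0 i) f (t *: x) - \sum_(j < k.+1) t ^+ j * peval (Q i j) x|
      <= e / S * t ^+ k.
  have H i := (HQ i).2 x _ (divr_gt0 e0 S0).
  have /boolp.choice[r Hr] : forall i, exists r, 0 < r /\ forall t, 0 <= t < r ->
    `|'D_(delta_mx ord0 i) f (t *: x) - \sum_(j < k.+1) t ^+ j * peval (Q i j) x|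
      <= e / S * t ^+ k.
    by move=> i; have [r r0 ?] := H i; exists r.
  (* The default 1 keeps the radius positive even without coordinates. *)
  exists (\big[Num.min/1]_(i < n) r i).
    by elim/big_ind: _ => // [a b a0 b0|i _]; [rewrite lt_min a0 | have [] := Hr i].
  move=> i t /andP[t0 tr]; apply: (Hr i).2; rewrite t0 /=.
  by apply: lt_le_trans tr _; exact: bigmin_le_cond.
(* The Taylor polynomial on the ray; by [qE] its derivative is the combination of the expansions
   [Q i] with the coordinates of [x] as weights. *)
pose P : {poly R} := \poly_(j < k.+2) peval (q j) x.
have PE t : P.[t] = \sum_(j < k.+2) t ^+ j * peval (q j) x.
  by rewrite horner_poly; apply: eq_bigr => j _; rewrite mulrC.
have P'E t : P^`().[t] =
    \sum_(j < k.+1) t ^+ j * \sum_(i < n) x ord0 i * peval (Q i j) x.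
  rewrite (@horner_coef_wide _ k.+1); last first.
    by apply: leq_trans (size_poly _ _) _; rewrite -subn1 leq_subLR size_poly.
  apply: eq_bigr => j _.
  by rewrite coef_deriv coef_poly ltnS ltn_ord -mulr_natl qE mulrC.
have dF (t : R) : is_derive t 1 (fun s : R => f (0 + s *: x) - P.[s])
   (\sum_(i < n) x ord0 i * 'D_(delta_mx ord0 i) f (t *: x) - P^`().[t]).
  apply: is_deriveB.
  have D := is_derive_gradient (0 + t *: x) x dfx (fun i => class_C_continuous (Cdf i)).
  rewrite -[t *: x]add0r -(@derive_val _ _ _ _ _ _ _ D).
  exact: is_derive_along_line.
exists r => // t /andP[t0 tr].
have [s] := MVT_segment t0 (fun s _ => dF s)
  (derivable_within_continuous (fun s _ => @ex_derive _ _ _ _ _ _ _ (dF s))).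
rewrite in_itv /= => /andP[s0 st] /=.
rewrite !add0r scale0r subr0.
have -> : f 0 - P.[0] = 0.
  by rewrite horner_coef0 coef_poly /= /peval mevalC subrr.
rewrite subr0 -PE => ->.
rewrite normrM (ger0_norm t0) exprSr mulrA ler_wpM2r // P'E.
under [X in _ - X]eq_bigr => j _ do rewrite mulr_sumr.
rewrite exchange_big /= -sumrB.
apply: le_trans (ler_norm_sum _ _ _) _.
have bound i : `|x ord0 i * 'D_(delta_mx ord0 i) f (s *: x)
    - \sum_(j < k.+1) s ^+ j * (x ord0 i * peval (Q i j) x)|
    <= `|x ord0 i| * (e / S * t ^+ k).
  under eq_bigr => j _ do rewrite mulrCA.
  rewrite -mulr_sumr -mulrBr normrM ler_wpM2l //.
  have sr : 0 <= s < r by rewrite s0 (le_lt_trans st).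
  apply: le_trans (Hr i s sr) _.
  by apply: ler_wpM2l; [exact/ltW/divr_gt0 | rewrite lerXn2r].
apply: le_trans (ler_sum _ (fun i _ => bound i)) _.
rewrite -mulr_suml mulrA ler_wpM2r ?exprn_ge0 // mulrCA ler_piMr ?ltW //.
by rewrite ltr_pdivrMr // mul1r ltrDr.
Qed.

(** Small [t] forces the constant coefficient to vanish; dividing by [t] then lowers [k] by one. *)
Lemma low_order_coef_eq0 k (c : nat -> R) (C r : R) : 0 < r ->
  (forall t, 0 < t < r -> `|\sum_(j < k.+1) t ^+ j * c j| <= C * t ^+ k) ->
  forall j, (j < k)%N -> c j = 0.
Proof.
move=> r0; elim: k c => [//|k IHk] c H.
have c0 : c 0%N = 0.
  apply/eqP; rewrite -normr_eq0; apply/eqP/le_anti.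
  rewrite normr_ge0 andbT; apply/ler_addgt0Pl => e e0; rewrite addr0.
  (* For [t <= 1] every positive power of [t] is at most [t], so [c 0] is bounded by [t * B]; the
     last summand 1 makes [B] positive. *)
  pose B := `|C| + \sum_(j < k.+1) `|c j.+1| + 1.
  have B0 : 0 < B by rewrite ltr_wpDl ?addr_ge0 ?sumr_ge0.
  pose t := Num.min 1 (Num.min (r / 2) (e / B)).
  have t0 : 0 < t by rewrite !lt_min ltr01 !divr_gt0.
  have tr : t < r by rewrite !gt_min (_ : r / 2 < r) ?orbT //; lra.
  have t1 : t <= 1 by rewrite ge_min lexx.
  have tB : t * B <= e by rewrite -ler_pdivlMr // !ge_min lexx !orbT.
  have := H t; rewrite t0 tr => /(_ isT).
  rewrite big_ord_recl expr0 mul1r => Ht.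
  have -> : c 0%N = (c 0%N + \sum_(j < k.+1) t ^+ (bump 0 j) * c (bump 0 j))
     - \sum_(j < k.+1) t ^+ (bump 0 j) * c (bump 0 j) by rewrite addrK.
  apply: le_trans (ler_normB _ _) _; apply: le_trans tB.
  apply: le_trans (lerD Ht (ler_norm_sum _ _ _)) _.
  rewrite /B 2!mulrDr mulr1; apply: ler_wpDr; [exact: ltW | apply: lerD].
    rewrite exprS mulrCA; apply: ler_wpM2l; first exact: ltW.
    apply: le_trans (ler_wpM2r (exprn_ge0 _ (ltW t0)) (ler_norm C)) _.
    by rewrite ler_piMr // exprn_ile1 // ltW.
  rewrite mulr_sumr; apply: ler_sum => j _.
  rewrite normrM ger0_norm; last by rewrite exprn_ge0 // ltW.
  rewrite ler_wpM2r // /bump add1n exprS; apply: ler_piMr; first exact: ltW.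
  by rewrite exprn_ile1 // ltW.
case=> [//|j]; rewrite ltnS => jk.
apply: (IHk (fun j => c j.+1)) => // t /andP[t0 tr].
have := H t; rewrite t0 tr => /(_ isT).
rewrite big_ord_recl c0 mulr0 add0r.
under eq_bigr => i _ do rewrite lift0 exprS -mulrA.
by rewrite -mulr_sumr normrM (ger0_norm (ltW t0)) exprS mulrCA ler_pM2l.
Qed.

(** The growth bound kills all Taylor forms of degree below [k], so [q k] is the limit. Each ray is
    treated by itself, hence [C] may depend on [x]. *)
Lemma class_C_leading_form k f : class_C k f ->
  (forall x, exists C, forall t, 0 < t -> `|f (t *: x)| <= C * t ^+ k) ->
  exists2 q : mpoly n R, q \is ishomog1 k mdeg &
    forall x, (fun t => f (t *: x) / t ^+ k) @ 0^'+ --> peval q x.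
Proof.
move=> /class_C_taylor[q [qh qf]] fO; exists (q k) => // x.
have q0 j : (j < k)%N -> peval (q j) x = 0.
  have [C HC] := fO x; have [r r0 Hr] := qf x 1 ltr01.
  (* In [C + 1], [C] bounds [f] and 1 bounds the Taylor error. *)
  apply: (@low_order_coef_eq0 k (fun j => peval (q j) x) (C + 1) r) => //.
  move=> t /andP[t0 tr].
  rewrite (_ : \sum_(_ < _) _ = f (t *: x) -
     (f (t *: x) - \sum_(j < k.+1) t ^+ j * peval (q j) x)); last by rewrite subKr.
  rewrite mulrDl; apply: le_trans (ler_normB _ _) _.
  by rewrite lerD // ?HC // Hr // ltW.
apply/cvgrPdist_le => e e0; have [r r0 Hr] := qf x e e0.
near=> t.
have t0 : 0 < t by near: t; exact: nbhs_right_gt.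
have tk : 0 < t ^+ k by rewrite exprn_gt0.
have := Hr t; rewrite ltW //= => /(_ _)/wrap[].
  by near: t; exact: nbhs_right_lt.
rewrite big_ord_recr /= big1 => [|j _]; last by rewrite q0 ?mulr0.
rewrite add0r distrC -ler_pdivrMr // -[in X in _ / X](ger0_norm (ltW tk)) -normf_div.
by rewrite mulrBl [t ^+ k * _]mulrC mulfK // gt_eqF.
Unshelve. all: by end_near.
Qed.

End TaylorForms.

(** * From a representation by regulous functions to one by forms *)

Theorem theorem3p7 (R : realType) (k d n : nat) :
  (1 <= k)%N -> (1 <= d)%N -> (2 <= n)%N ->
  (pythagoras_number_forms R (2 * d) n k
     <= pythagoras_number (2 * d) (regulous_ring R n k))%E.
Proof.
move=> _ d_gt0 _; apply: le_least_positive => g Hg s /allP s_hom.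
have even_ge0 (a : R) : 0 <= a ^+ (2 * d) by rewrite exprM exprn_ge0 ?sqr_ge0.
have [t st] := Hg [seq regulous_of_mpoly k p | p <- s].
pose S x := \sum_(p <- s) peval p x ^+ (2 * d).
have SE (x : 'rV[R]_n) : S x = \sum_(f <- t) regulous_fun f x ^+ (2 * d).
  move/(congr1 (fun F : regulous_ring R n k => regulous_fun F x)): st.
  have valE (r : seq (regulous_ring R n k)) :
      regulous_fun (\sum_(f <- r) f ^+ (2 * d)) x =
      \sum_(f <- r) regulous_fun f x ^+ (2 * d).
    rewrite -[regulous_fun (bigop _ _ _)]/(\val _) raddf_sum fct_sumE.
    by apply: eq_bigr => f _; rewrite -[LHS]/((\val (f ^+ (2 * d))) x) rmorphXn fctE.
  by rewrite !valE big_map.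
have S_hom x a : S (a *: x) = a ^+ (2 * d * k) * S x.
  rewrite /S mulr_sumr !big_seq; apply: eq_bigr => p /s_hom hp.
  by rewrite (peval_homog _ _ hp) exprMn -exprM mulnC.
have leading f : f \in tval t -> exists2 q : mpoly n R, q \is ishomog1 k mdeg &
    forall x, (fun a => regulous_fun f (a *: x) / a ^+ k) @ 0^'+ --> peval q x.
  move=> ft; apply: class_C_leading_form => [|x].
    by have /asboolP[] := valP f.
  (* A number that is at least 1 is at most its own [2 * d]-th power, so this constant bounds the
     growth of [f] without extracting a root of [S x]. *)
  exists (Num.max 1 (S x)) => a a0.
  have C0 : 0 <= Num.max 1 (S x) * a ^+ k.
    by rewrite mulr_ge0 ?exprn_ge0 ?le_max ?ler01 // ltW.
  have d2 : (0 < 2 * d)%N by rewrite muln_gt0.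
  rewrite -(ler_pXn2r d2) ?nnegrE //.
  rewrite -normrX ger0_norm //; apply: le_trans (_ : S (a *: x) <= _).
    by rewrite SE (big_rem f) //= lerDl sumr_ge0.
  rewrite S_hom exprMn -exprM [(k * _)%N]mulnC mulrC.
  rewrite ler_wpM2r ?exprn_ge0 ?(ltW a0) //.
  apply: le_trans (_ : Num.max 1 (S x) <= _); first by rewrite le_max lexx orbT.
  by rewrite -[leLHS]expr1 ler_weXn2l // le_max lexx.
have [Q HQ] : exists Q : regulous_ring R n k -> mpoly n R, forall f, f \in tval t ->
    Q f \is ishomog1 k mdeg /\
    forall x, (fun a => regulous_fun f (a *: x) / a ^+ k) @ 0^'+ --> peval (Q f) x.
  have /boolp.choice[Q HQ] : forall f : regulous_ring R n k, exists q, f \in tval t ->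
    q \is ishomog1 k mdeg /\
    forall x, (fun a => regulous_fun f (a *: x) / a ^+ k) @ 0^'+ --> peval q x.
    (* Choice needs a value for every [f]; outside [t] it is 0. *)
    move=> f; have [/leading[q qh qf]|_] := boolP (f \in tval t); last by exists 0.
    by exists q.
  by exists Q.
exists (map Q t); split; first by rewrite size_map size_tuple.
  by apply/allP => _ /mapP[f /HQ[Qf _] ->].
apply: peval_inj => x.
have sumE (r : seq (mpoly n R)) :
    peval (\sum_(p <- r) p ^+ (2 * d)) x = \sum_(p <- r) peval p x ^+ (2 * d).
  by rewrite /peval raddf_sum; apply: eq_bigr => p _; rewrite /= rmorphXn.
rewrite !sumE big_map -/(S x).
have lim : (fun a => \sum_(f <- t) (regulous_fun f (a *: x) / a ^+ k) ^+ (2 * d))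
    @ 0^'+ --> \sum_(f <- t) peval (Q f) x ^+ (2 * d).
  rewrite !big_seq; under eq_fun do rewrite big_seq.
  apply: cvg_big => [|f /HQ[_ Qf]]; first exact: add_continuous.
  exact: cvg_comp (Qf x) (@exprn_continuous R (2 * d)%N _).
(* By homogeneity of [S] the sum inside [lim] is constantly [S x] for [a > 0], so its limit is [S x]
   too. *)
apply: (cvg_unique _ _ lim) => //; apply: cvg_near_cst.
near=> a; have a0 : 0 < a by near: a; exact: nbhs_right_gt.
under eq_bigr => f _ do rewrite expr_div_n.
rewrite -mulr_suml -SE S_hom -exprM [(k * _)%N]mulnC [_ * S x]mulrC mulfK //.
by rewrite gt_eqF // exprn_gt0.
Unshelve. all: by end_near.
Qed.
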